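(* Let $\gamma$ denote the maximum value of the function \[ f(x)=\frac{x^2}{2}\left(\frac{x^2}{2}+\frac{(1-x)^2}{2}\right)\left(x(1-x)+\frac{(1-x)^2}{2}\right) \] over $x\in[0,1]$. Then there exist graphs $G_1,G_2,G_3$ on a common vertex set of size $n$ with no rainbow triangle such that \[ e(G_1)e(G_2)e(G_3)\ge \gamma n^6(1-o(1)), \] where $o(1)$ denotes a quantity tending to $0$ as $n\to\infty$; that is, there is a function $\varepsilon(n)\to 0$ such that for every $n$ there are such graphs with $e(G_1)e(G_2)e(G_3)\ge \gamma n^6(1-\varepsilon(n))$.
   Context: All graphs are simple. For a graph $G$, $e(G)=|E(G)|$ is its number of edges. Given graphs $G_1,G_2,G_3$ on a common vertex set, a rainbow triangle is a set of three distinct vertices $u,v,w$ such that the three edges $uv, vw, uw$ can be assigned to $G_1,G_2,G_3$ bijectively, each edge lying in the edge set of the graph it is assigned to (i.e., the triangle consists of one edge from each $G_i$). *)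

(* Defs.v *)
From HB Require Import structures.
From mathcomp Require Import all_boot all_order all_fingroup all_algebra.
From mathcomp Require Import all_classical all_reals all_analysis.

Set Implicit Arguments.
Unset Strict Implicit.
Unset Printing Implicit Defensive.

Import Order.TTheory GRing.Theory Num.Theory.
Import numFieldNormedType.Exports.

Local Open Scope classical_set_scope.
Local Open Scope ring_scope.

Record sgraph (V : finType) := SGraph {
  edges : {set {set V}};
  edges_card : {in edges, forall A : {set V}, #|A| = 2%N}
}.

Definition e (V : finType) (G : sgraph V) : nat := #|edges G|.

Definition triangle_edges (V : finType) (u v w : V) : 3.-tuple {set V} :=
  [tuple [set u; v]%SET; [set v; w]%SET; [set u; w]%SET].

(* The permutation s is the bijection between the edges of the triangle and
   the three graphs. *)
Definition rainbow_triangle (V : finType) (G1 G2 G3 : sgraph V) (u v w : V) :=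
  uniq [:: u; v; w] /\
  exists s : {perm 'I_3}, forall i : 'I_3,
    tnth (triangle_edges u v w) i \in edges (tnth [tuple G1; G2; G3] (s i)).

Definition f (R : realType) (x : R) : R :=
  x ^+ 2 / 2 * (x ^+ 2 / 2 + (1 - x) ^+ 2 / 2)
  * (x * (1 - x) + (1 - x) ^+ 2 / 2).

Definition is_maximum (R : realType) (A : set R) (m : R) :=
  A m /\ ubound A m.

Lemma f_has_maximum (R : realType) :
  exists gamma : R, is_maximum (@f R @` `[0, 1]) gamma.
Proof.
have cf : {within `[0, 1], continuous (@f R)}.
  apply: continuous_subspaceT => x.
  have c1 : {for x, continuous (fun y : R => 1 - y)}.
    by apply: cvgB; [exact: cvg_cst | exact: cvg_id].
  have c2 : {for x, continuous (fun y : R => (1 - y) ^+ 2 / 2)}.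
    apply: cvgM; last exact: cvg_cst.
    by under eq_fun do rewrite expr2; apply: cvgM.
  have c3 : {for x, continuous (fun y : R => y ^+ 2 / 2)}.
    apply: cvgM; last exact: cvg_cst.
    by under eq_fun do rewrite expr2; apply: cvgM; exact: cvg_id.
  apply: cvgM; first by apply: cvgM => //; apply: cvgD.
  by apply: cvgD => //; apply: cvgM => //; exact: cvg_id.
have [c c01 cmax] := EVT_max (ler01 : (0 : R) <= 1) cf.
exists (f c); split; first by exists c.
by move=> _ [x x01 <-]; exact: cmax.
Qed.

(* Main.v *)
Require Import Defs.
From HB Require Import structures.
From mathcomp Require Import all_boot all_order all_fingroup all_algebra.
From mathcomp Require Import all_classical all_reals all_analysis.
From mathcomp Require Import ring lra.
Set Implicit Arguments.
Unset Strict Implicit.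
Unset Printing Implicit Defensive.

Import Order.TTheory GRing.Theory Num.Theory.
Import numFieldNormedType.Exports.
Local Open Scope classical_set_scope.
Local Open Scope ring_scope.

(** Split the vertices into [A] and its complement [B]. Let the first graph be
    the clique on [A], the second the disjoint union of the cliques on [A] and
    [B], and the third all the pairs not inside [A]. The edge of the first graph
    in a rainbow triangle lies inside [A]. The third vertex is not in [A], as
    the third graph has no edge inside [A]; it is not in [B] either, as the
    second graph has no edge between [A] and [B]. If [A] has [floor (c n)]
    elements, where [c] maximizes [f], the product of the three edge densities
    tends to [f c]. *)

Definition pairs_in (V : finType) (A : {set V}) : {set {set V}} :=
  [set B : {set V} | (B \subset A) && (#|B| == 2%N)]%SET.

Lemma card_pairs_in (V : finType) (A : {set V}) : #|pairs_in A| = 'C(#|A|, 2).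
Proof. exact: cards_draws. Qed.

Lemma set2_in_pairs_in (V : finType) (A : {set V}) (u v : V) :
  ([set u; v]%SET \in pairs_in A) = [&& u \in A, v \in A & u != v].
Proof. by rewrite inE finset.subUset !finset.sub1set cards2 -andbA; case: (u != v). Qed.

Section Construction.
Variables (V : finType) (A : {set V}).

Lemma clique_on_card2 : {in pairs_in A, forall B : {set V}, #|B| = 2%N}.
Proof. by move=> B; rewrite inE => /andP[_ /eqP]. Qed.

Lemma clique_pair_card2 :
  {in pairs_in A :|: pairs_in (~: A), forall B : {set V}, #|B| = 2%N}.
Proof. by move=> B; rewrite !inE => /orP[] /andP[_ /eqP]. Qed.

Lemma clique_compl_card2 :
  {in pairs_in [set: V] :\: pairs_in A, forall B : {set V}, #|B| = 2%N}.
Proof. by move=> B; rewrite !inE => /and3P[_ _ /eqP]. Qed.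

Definition clique_on := SGraph clique_on_card2.
Definition clique_pair := SGraph clique_pair_card2.
Definition clique_compl := SGraph clique_compl_card2.

Lemma e_clique_on : e clique_on = 'C(#|A|, 2).
Proof. exact: card_pairs_in. Qed.

Lemma e_clique_pair : e clique_pair = ('C(#|A|, 2) + 'C(#|V| - #|A|, 2))%N.
Proof.
have disj : pairs_in A :&: pairs_in (~: A) = finset.set0.
  apply/finset.setP => B; rewrite !inE; apply/negP => /andP[/andP[BA /eqP B2]].
  move=> /andP[BC _]; have : B \subset A :&: ~: A by rewrite finset.subsetI BA.
  by rewrite finset.setICr finset.subset0 => /eqP B0; rewrite B0 cards0 in B2.
rewrite /e /= finset.cardsU disj cards0 subn0 !card_pairs_in.
by rewrite [#|~: A|]cardsCs finset.setCK.
Qed.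

Lemma e_clique_compl : e clique_compl = ('C(#|V|, 2) - 'C(#|A|, 2))%N.
Proof.
have sub : pairs_in [set: V] :&: pairs_in A = pairs_in A.
  by apply/finset.setP => B; rewrite !inE finset.subsetT /=;
    case: (#|B| == 2%N); rewrite ?andbT ?andbF.
by rewrite /e /= cardsD sub !card_pairs_in cardsT.
Qed.

Lemma no_rainbow_triangle (u v w : V) :
  ~ rainbow_triangle clique_on clique_pair clique_compl u v w.
Proof.
move=> [_ [s s_edge]].
pose E := triangle_edges u v w.
(* Inverting [s] gives the positions [i1], [i2], [i3] of the edges taken from the first, second and
   third graph. *)
pose i1 := (s^-1)%g (inord 0); pose i2 := (s^-1)%g (inord 1).
pose i3 := (s^-1)%g (inord 2).
have E1 : tnth E i1 \in edges clique_on.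
  by have := s_edge i1; rewrite permKV (tnth_nth clique_on) /= inordK.
have E2 : tnth E i2 \in edges clique_pair.
  by have := s_edge i2; rewrite permKV (tnth_nth clique_on) /= inordK.
have E3 : tnth E i3 \in edges clique_compl.
  by have := s_edge i3; rewrite permKV (tnth_nth clique_on) /= inordK.
have i12 : i1 != i2 by rewrite (inj_eq perm_inj) -val_eqE /= !inordK.
have i13 : i1 != i3 by rewrite (inj_eq perm_inj) -val_eqE /= !inordK.
have i23 : i2 != i3 by rewrite (inj_eq perm_inj) -val_eqE /= !inordK.
move: i1 i2 i3 E1 E2 E3 i12 i13 i23.
move=> [[|[|[|//]]] ?] [[|[|[|//]]] ?] [[|[|[|//]]] ?] //=.
all: rewrite 3!(tnth_nth finset.set0) /= finset.in_setU finset.in_setD.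
all: rewrite !set2_in_pairs_in !finset.in_setC !finset.in_setT /=.
all: case: (u \in A); case: (v \in A); case: (w \in A) => //=.
(* Only the case of three vertices in [A] survives. There, avoiding [pairs_in A] forces the ends of
   the third edge to coincide, while being a pair keeps them distinct. *)
all: by move=> _ _ /andP[/negP ?].
Qed.

End Construction.

Section Asymptotics.
Variable R : realType.

Lemma natr_bin2 (m : nat) : 'C(m, 2)%:R = m%:R * (m%:R - 1) / 2 :> R.
Proof.
case: m => [|m]; first by rewrite bin0n !mul0r.
have /(congr1 (fun k => k%:R : R)) := mul_bin_diag m.+1 1.
rewrite bin1 !natrM => E; rewrite -[in RHS]natr1 addrK natr1.
apply: (mulfI (_ : 2%:R != 0 :> R)); first by rewrite pnatr_eq0.
by rewrite -E [RHS]mulrC divfK ?pnatr_eq0.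
Qed.

(** This is the product of the three edge counts when [A] has [k] of the [n] vertices. *)
Definition split_product (n k : nat) : nat :=
  'C(k, 2) * ('C(k, 2) + 'C(n - k, 2)) * ('C(n, 2) - 'C(k, 2)).

(** This is [split_product n k] scaled by [n ^ 6], in the variables [y = k / n] and [h = 1 / n]. The
    lower-order terms are those containing [h], so [h = 0] gives back [f y]. *)
Definition split_density (y h : R) : R :=
  y * (y - h) / 2 * (y * (y - h) / 2 + (1 - y) * (1 - y - h) / 2)
  * ((1 - h) / 2 - y * (y - h) / 2).

Lemma split_densityE (n k : nat) : (0 < n)%N -> (k <= n)%N ->
  (split_product n k)%:R / n%:R ^+ 6 = split_density (k%:R / n%:R) n%:R^-1.
Proof.
move=> n0 kn; rewrite !natrM natrD natrB ?leq_bin2l // !natr_bin2 natrB //.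
by rewrite /split_density; field; rewrite pnatr_eq0 -lt0n.
Qed.

Lemma split_density0 (y : R) : split_density y 0 = f y.
Proof. by rewrite /split_density /f; field. Qed.

Lemma cvg_split_density (y h : nat -> R) (c : R) :
  y n @[n --> \oo] --> c -> h n @[n --> \oo] --> (0 : R) ->
  split_density (y n) (h n) @[n --> \oo] --> f c.
Proof.
move=> yc h0; rewrite -split_density0.
have c1 : (fun=> 1 : R) @ \oo --> (1 : R) by exact: cvg_cst.
have ch : (fun=> 2^-1 : R) @ \oo --> (2^-1 : R) by exact: cvg_cst.
have y2 : y n * (y n - h n) / 2 @[n --> \oo] --> c * (c - 0) / 2.
  by apply: cvgM => //; apply: cvgM => //; apply: cvgB.
apply: cvgM; last by apply: cvgB => //; apply: cvgM => //; apply: cvgB.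
apply: cvgM => //; apply: cvgD => //.
by apply: cvgM => //; apply: cvgM; do ?apply: cvgB.
Qed.

Lemma cvg_invn : (n%:R^-1 : R) @[n --> \oo] --> (0 : R).
(* The terms of [harmonic] are [1 / (n + 1)], hence the shift. *)
Proof. by rewrite -(cvg_shiftS (fun n => n%:R^-1 : R)); exact: cvg_harmonic. Qed.

(** The floor lies between [c n - 1] and [c n]; dividing by [n] squeezes the quotient between
    [c - 1 / n] and [c]. *)
Lemma cvg_truncn_div (c : R) : 0 <= c ->
  ((Num.truncn (c * n%:R))%:R / n%:R : R) @[n --> \oo] --> c.
Proof.
move=> c0; apply: (@squeeze_cvgr _ _ _ _ (fun n => c - n%:R^-1) (fun=> c)).
- near=> n.
  have n0 : 0 < n%:R :> R by rewrite ltr0n; near: n; exact: nbhs_infty_gt.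
  have /truncn_itv/andP[lo hi] : 0 <= c * n%:R by rewrite mulr_ge0.
  rewrite ler_pdivrMr // lo andbT ler_pdivlMr // mulrBl mulVf ?gt_eqF //.
  by rewrite lerBlDr natr1 ltW.
- by rewrite -[X in _ --> X]subr0; apply: cvgB; [exact: cvg_cst|exact: cvg_invn].
- exact: cvg_cst.
Unshelve. all: by end_near. Qed.

End Asymptotics.

Theorem theorem2 (R : realType) (gamma : R)
    (gamma_max : is_maximum [set f x | x in `[0, 1]] gamma) :
  exists eps : nat -> R,
    (eps n @[n --> \oo] --> (0 : R)) /\
    forall n : nat, exists G1 G2 G3 : sgraph 'I_n,
      ~ (exists u v w : 'I_n, rainbow_triangle G1 G2 G3 u v w) /\
      (e G1)%:R * (e G2)%:R * (e G3)%:R >= gamma * n%:R ^+ 6 * (1 - eps n).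
Proof.
case: gamma_max => -[c]; rewrite /= in_itv /= => /andP[c0 c1] fc gamma_ub.
(* Positivity allows division by [gamma] in the error term; the value of [f] at [1 / 2] is
   [3 / 256]. *)
have gamma_gt0 : 0 < gamma.
  apply: (@lt_le_trans _ _ (f (2^-1 : R))); first by rewrite /f; lra.
  by apply: gamma_ub; exists 2^-1 => //=; rewrite in_itv /=; lra.
have gamma_neq0 : gamma != 0 by rewrite gt_eqF.
pose k n := Num.truncn (c * n%:R).
have kn n : (k n <= n)%N.
  rewrite -(ler_nat R); apply: (@le_trans _ _ (c * n%:R)).
    by rewrite truncn_le mulr_ge0.
  by rewrite ler_piMl.
(* The error is chosen to turn the required bound into an equality for every positive [n]; it tends
   to [1 - f c / gamma = 0]. *)
exists (fun n => 1 - (split_product n (k n))%:R / n%:R ^+ 6 / gamma); split.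
  rewrite -[X in _ --> X](subrr 1) -[X in _ --> _ - X](divff gamma_neq0) -{2}fc.
  apply: cvgB; first exact: cvg_cst.
  apply: cvgM; last exact: cvg_cst.
  apply: cvg_trans (cvg_split_density (cvg_truncn_div c0) (@cvg_invn R)).
  apply: near_eq_cvg; near=> n; rewrite split_densityE //.
  by near: n; exact: nbhs_infty_gt.
move=> n.
pose A : {set 'I_n} := [set i : 'I_n | (i < k n)%N]%SET.
have cardA : #|A| = k n.
  rewrite -sum1_card (eq_bigl (fun i : 'I_n => (i < k n)%N)).
    by rewrite (big_ord_narrow (kn n)) sum1_card card_ord.
  by move=> i; rewrite inE.
exists (clique_on A), (clique_pair A), (clique_compl A); split.
  by move=> [u [v [w]]]; exact: no_rainbow_triangle.
rewrite e_clique_on e_clique_pair e_clique_compl card_ord cardA -!natrM subKr.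
(* For [n = 0] the error term divides by zero, but the factor [n ^ 6] makes the lower bound
   vanish. *)
have [->|n0] := posnP n; first by rewrite expr0n mulr0 mul0r ler0n.
rewrite le_eqVlt; apply/orP; left; apply/eqP; rewrite /split_product.
by field; rewrite gamma_neq0 pnatr_eq0 -lt0n.
Unshelve. all: by end_near. Qed.
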